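(* Let $k\ge2$ and let $\mathscr V$ be a flag $\langle\mathbf 1\rangle=V_0<V_1<\cdots<V_r\le\mathbb Q^k$. There exists a finite family $\mathscr F(\mathscr V)$ of subflags of $\mathscr V$ such that $$\#\mathscr F(\mathscr V)\le\bigl((k+1)2^{3^k}\bigr)^k=O_k(1),$$ and, for every subflag $\mathscr V'\le\mathscr V$, there exists $\mathscr V''\in\mathscr F(\mathscr V)$ satisfying $$\dim V'_j=\dim V''_j,\qquad \mathbb H_\mu(V'_j)=\mathbb H_\mu(V''_j)\qquad(0\le j\le r)$$ for every probability measure $\mu$ supported on $\{0,1\}^k$. Consequently, for every threshold sequence $\mathbf c$ and every family $\boldsymbol\mu=(\mu_1,\ldots,\mu_r)$ of probability measures supported on $\{0,1\}^k$, we have $\mathrm e(\mathscr V',\mathbf c,\boldsymbol\mu)=\mathrm e(\mathscr V'',\mathbf c,\boldsymbol\mu)$. Moreover, if $\mathscr V'<\mathscr V$, then $\mathscr V''<\mathscr V$.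
   Context: Vector spaces are over $\mathbb Q$; $\mathbf 1=(1,\dots,1)\in\mathbb Q^k$; $\{0,1\}^k\subset\mathbb Q^k$; logarithms are natural and $0\log0=0$. $U\le V$ means $U$ is a subspace of $V$, and $U<V$ a proper subspace. A subflag $\mathscr V'\le\mathscr V$ of $\mathscr V=(V_0,\dots,V_r)$ is a sequence $\langle\mathbf 1\rangle=V_0'\le V_1'\le\cdots\le V_r'$ of subspaces with $V_j'\le V_j$ for all $0\le j\le r$; it is proper, written $\mathscr V'<\mathscr V$, if $V_j'<V_j$ for at least one $1\le j\le r$. A threshold sequence is $\mathbf c=(c_1,\dots,c_{r+1})$ with $1\ge c_1\ge\cdots\ge c_{r+1}\ge0$. For a finitely supported probability measure $\mu$ on $\mathbb Q^k$ and $W\le\mathbb Q^k$, put $\mu(W+x)=\sum_{y\in W+x}\mu(y)$ and $\mathbb H_\mu(W)=-\sum_x\mu(x)\log\mu(W+x)$. For a subflag $\mathscr V'$ of $\mathscr V$, $$\mathrm e(\mathscr V',\mathbf c,\boldsymbol\mu)=\sum_{j=1}^r(c_j-c_{j+1})\mathbb H_{\mu_j}(V_j')+\sum_{j=1}^rc_j\dim(V_j'/V_{j-1}').$$ *)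

(* Defs.v *)
From HB Require Import structures.
From mathcomp Require Import all_boot all_order all_algebra finmap.
From mathcomp Require Import all_classical all_reals all_analysis.

Set Implicit Arguments.
Unset Strict Implicit.
Unset Printing Implicit Defensive.

Import Order.TTheory GRing.Theory Num.Theory.

Local Open Scope classical_set_scope.
Local Open Scope ring_scope.

Notation "''Q^' k" := ('rV[rat]_k) (at level 8, k at level 2) : type_scope.

(* (V_0, ..., V_r), so r is the index of the last space, not the length. *)
Notation vseq k r := {ffun 'I_r.+1 -> {vspace 'rV[rat]_k}}.

Definition ones (k : nat) : 'Q^k := const_mx 1.

Definition cube (k : nat) : set 'Q^k :=
  [set x | forall i, x ord0 i = 0 \/ x ord0 i = 1].

(* For j in {0, ..., r-1}: in a sequence indexed from 0 these pick the entries
   j and j+1. *)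
Definition ord_lo (r : nat) (j : 'I_r) : 'I_r.+1 := widen_ord (leqnSn r) j.
Definition ord_hi (r : nat) (j : 'I_r) : 'I_r.+1 := lift ord0 j.

Definition proper_subspace (k : nat) (U W : {vspace 'Q^k}) : Prop :=
  (U <= W)%VS /\ U <> W.

Definition is_flag (k r : nat) (V : vseq k r) : Prop :=
  V ord0 = <[ones k]>%VS /\
  forall j : 'I_r, proper_subspace (V (ord_lo j)) (V (ord_hi j)).

Definition subflag (k r : nat) (V' V : vseq k r) : Prop :=
  [/\ V' ord0 = <[ones k]>%VS,
      forall j : 'I_r, (V' (ord_lo j) <= V' (ord_hi j))%VS
    & forall j : 'I_r.+1, (V' j <= V j)%VS].

Definition proper_subflag (k r : nat) (V' V : vseq k r) : Prop :=
  subflag V' V /\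
  exists j : 'I_r.+1, (1 <= j)%N /\ proper_subspace (V' j) (V j).

(* Finitely supported probability measures on Q^k, given by their mass
   function. *)
Record fsprob (R : realType) (k : nat) := FSProb {
  mass :> 'Q^k -> R;
  mass_ge0 : forall x, 0 <= mass x;
  mass_fin : finite_set [set x | mass x != 0];
  mass_sum1 : \sum_(x \in [set: 'Q^k]) mass x = 1
}.

Definition supported_on (R : realType) (k : nat) (mu : fsprob R k)
    (A : set 'Q^k) : Prop :=
  [set x | mu x != 0] `<=` A.

Definition coset_set (k : nat) (W : {vspace 'Q^k}) (x : 'Q^k) : set 'Q^k :=
  [set w + x | w in [set w | w \in W]].

Definition coset_mass (R : realType) (k : nat) (mu : fsprob R k)
    (W : {vspace 'Q^k}) (x : 'Q^k) : R :=
  \sum_(y \in coset_set W x) mu y.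

(* The sum is over x in Q^k, with finitely many nonzero terms; the convention
   0 log 0 = 0 is automatic since ln is total. *)
Definition entropy (R : realType) (k : nat) (mu : fsprob R k)
    (W : {vspace 'Q^k}) : R :=
  - \sum_(x \in [set: 'Q^k]) (mu x * ln (coset_mass mu W x)).

(* c i is the threshold c_(i+1) of the sequence (c_1, ..., c_(r+1)). *)
Definition is_threshold (R : realType) (r : nat) (c : 'I_r.+1 -> R) : Prop :=
  [/\ c ord0 <= 1,
      forall j : 'I_r, c (ord_hi j) <= c (ord_lo j)
    & 0 <= c ord_max].

(* dim (U / W), for W <= U. *)
Definition dim_quot (k : nat) (U W : {vspace 'Q^k}) : nat :=
  (\dim U - \dim W)%N.

(* The summation index j : 'I_r stands for j+1 in {1, ..., r}; accordingly
   mu j is mu_(j+1), c (ord_lo j) is c_(j+1), c (ord_hi j) is c_(j+2), and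
   V' (ord_hi j), V' (ord_lo j) are V'_(j+1), V'_j. *)
Definition flag_e (R : realType) (k r : nat) (V' : vseq k r)
    (c : 'I_r.+1 -> R) (mu : 'I_r -> fsprob R k) : R :=
  \sum_(j < r) (c (ord_lo j) - c (ord_hi j)) * entropy (mu j) (V' (ord_hi j))
  + \sum_(j < r) c (ord_lo j) * (dim_quot (V' (ord_hi j)) (V' (ord_lo j)))%:R.

(* Main.v *)
Require Import Defs.
From HB Require Import structures.
From mathcomp Require Import all_boot all_order all_algebra finmap.
From mathcomp Require Import all_classical all_reals all_analysis.

Set Implicit Arguments.
Unset Strict Implicit.
Unset Printing Implicit Defensive.

Import Order.TTheory GRing.Theory Num.Theory.

Local Open Scope ring_scope.
Local Open Scope fset_scope.

(** If [mu] lives on the cube, then [entropy mu W] only asks of [W] which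
    differences [y - x] of cube points it contains, and these differences lie
    in {-1, 0, 1}^k. So the pair formed by [\dim W] and the intersection of [W]
    with {-1, 0, 1}^k, called the profile of [W] below, already determines the
    dimension of [W] and all the entropies in question ([eq_entropy_profile]).
    It ranges over a set of (k + 1) * 2 ^ (3 ^ k) elements, although there are
    infinitely many subspaces.

    It is therefore enough that F contain one subflag of [V] for each sequence
    of profiles that comes from a subflag, and F need not have more elements
    than there are sequences ([finite_representatives]). Such a sequence has
    [r.+1] entries, and [r.+1 <= k] because the dimensions in a flag start at 1
    and increase strictly ([flag_length]); this gives the bound on the size
    of F.

    The functional [flag_e] is built from dimensions and entropies, so it is
    the same for a subflag and its representative, and properness passes
    to the representative because a subspace of [V j] is proper exactly when
    its dimension is smaller. *)

Section Entropy.
Variables (R : realType) (k : nat).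
Implicit Types (mu : fsprob R k) (U W : {vspace 'Q^k}).

Lemma coset_setE W (x y : 'Q^k) : (y \in coset_set W x) = (y - x \in W).
Proof.
apply/idP/idP => [|Wyx]; first by rewrite inE => -[w /= Ww <-]; rewrite addrK.
by rewrite inE; exists (y - x); rewrite /= ?subrK.
Qed.

(** Points of mass zero contribute neither to the coset masses nor to the
    outer sum, so only differences of two points of the support matter. *)
Lemma eq_entropy mu (A : set 'Q^k) U W : supported_on mu A ->
    (forall x y, A x -> A y -> (y - x \in U) = (y - x \in W)) ->
  entropy mu U = entropy mu W.
Proof.
move=> muA eqUW; rewrite /entropy; congr (- _); apply: eq_fsbigr => x _.
have [->|mux] := eqVneq (mu x) 0; first by rewrite !mul0r.
congr (_ * ln _); rewrite /coset_mass fsbig_mkcond [RHS]fsbig_mkcond.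
apply: eq_fsbigr => y _; rewrite /patch !coset_setE.
have [->|muy] := eqVneq (mu y) 0; first by rewrite !if_same.
by rewrite (eqUW x y) //; apply: muA.
Qed.

End Entropy.

Section Profile.
Variable k : nat.
Implicit Types U W : {vspace 'Q^k}.

(** [ternary] enumerates {-1, 0, 1}^k, shifting the digits 0, 1, 2 down
    by one. *)
Definition ternary (t : {ffun 'I_k -> 'I_3}) : 'Q^k :=
  \row_i ((t i)%:R - 1).

Lemma cube_sub_ternary (x y : 'Q^k) : cube x -> cube y ->
  exists t, ternary t = y - x.
Proof.
move=> cx cy.
exists [ffun i => if y ord0 i == x ord0 i then inord 1
                  else if y ord0 i == 0 then inord 0 else inord 2].
apply/rowP => i; rewrite !mxE ffunE.
by case: (cx i) => ->; case: (cy i) => ->; rewrite /= inordK.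
Qed.

Definition profile_type : finType :=
  ('I_k.+1 * {set {ffun 'I_k -> 'I_3}})%type.

(** Since [inord] sends out-of-range numbers to 0, the first entry is faithful
    only because [\dim W <= k]. *)
Definition profile W : profile_type :=
  (inord (\dim W), [set t | ternary t \in W]%SET).

Lemma card_profile_type : #|profile_type| = ((k + 1) * 2 ^ (3 ^ k))%N.
Proof.
by rewrite card_prod card_ord -cardsT -powersetT card_powerset cardsT card_ffun
           !card_ord addn1.
Qed.

Lemma dimv_le W : (\dim W <= k)%N.
Proof. by have := dimvS (subvf W); rewrite dimvf /dim /= mul1n. Qed.

Lemma eq_dim_profile U W : profile U = profile W -> \dim U = \dim W.
Proof. by case=> /(congr1 val); rewrite /= !inordK ?ltnS ?dimv_le. Qed.

Lemma eq_ternary_profile U W t : profile U = profile W ->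
  (ternary t \in U) = (ternary t \in W).
Proof. by case=> _ /setP/(_ t); rewrite !inE. Qed.

Lemma eq_entropy_profile (R : realType) (mu : fsprob R k) U W :
    profile U = profile W -> supported_on mu (@cube k) ->
  entropy mu U = entropy mu W.
Proof.
move=> eqUW mucube; apply: (eq_entropy mucube) => x y cx cy.
by have [t <-] := cube_sub_ternary cx cy; apply: eq_ternary_profile.
Qed.

End Profile.

Section Flags.
Variables k r : nat.
Implicit Types V : vseq k r.

Lemma proper_subspace_dim (U W : {vspace 'Q^k}) :
  proper_subspace U W <-> (U <= W)%VS /\ (\dim U < \dim W)%N.
Proof.
split=> -[UW neqUW]; split=> //; last by move=> eqUW; rewrite eqUW ltnn in neqUW.
by rewrite ltnNge; apply/negP => dimWU; apply/neqUW/eqP; rewrite eqEdim UW.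
Qed.

Lemma flag_length V : (0 < k)%N -> is_flag V -> (r.+1 <= k)%N.
Proof.
move=> k_gt0 [V0 Vlt].
suff dimV n (n_r : (n < r.+1)%N) : (n < \dim (V (Ordinal n_r)))%N.
  by apply: leq_trans (dimV r (ltnSn r)) (dimv_le _).
elim: n n_r => [|n IHn] n_r.
  have -> : Ordinal n_r = ord0 by apply: val_inj.
  rewrite V0 dim_vline lt0b; apply/eqP => /rowP/(_ (Ordinal k_gt0)).
  by rewrite !mxE.
have /proper_subspace_dim[_] := Vlt (Ordinal (n_r : (n < r)%N)).
have -> : ord_lo (Ordinal (n_r : (n < r)%N)) = Ordinal (ltnW n_r).
  exact: val_inj.
have -> : ord_hi (Ordinal (n_r : (n < r)%N)) = Ordinal n_r by apply: val_inj.
by apply: leq_trans; rewrite ltnS; apply: IHn.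
Qed.

Lemma proper_subflag_dim V (V' V'' : vseq k r) :
    (forall j, \dim (V' j) = \dim (V'' j)) -> subflag V'' V ->
  proper_subflag V' V -> proper_subflag V'' V.
Proof.
move=> eq_dim sV'' [_ [j [j_gt0 /proper_subspace_dim[_ lt_dim]]]].
split=> //; exists j; split=> //; apply/proper_subspace_dim.
by rewrite -eq_dim; split=> //; case: sV''.
Qed.

Lemma eq_flag_e (R : realType) (V' V'' : vseq k r) (c : 'I_r.+1 -> R)
    (mu : 'I_r -> fsprob R k) :
    (forall j, \dim (V' j) = \dim (V'' j)) ->
    (forall j, entropy (mu j) (V' (ord_hi j)) =
               entropy (mu j) (V'' (ord_hi j))) ->
  flag_e V' c mu = flag_e V'' c mu.
Proof.
move=> eq_dim eq_ent; rewrite /flag_e; congr (_ + _)%R; apply: eq_bigr => j _.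
  by rewrite eq_ent.
by rewrite /dim_quot !eq_dim.
Qed.

Definition profiles V : {ffun 'I_r.+1 -> profile_type k} :=
  [ffun j => profile (V j)].

End Flags.

(** A function into a finite type has at most as many values on a set as that
    type has elements, so the set has a small finite subset which already
    realises all of them. *)
Lemma finite_representatives (T : choiceType) (S : finType) (f : T -> S)
    (A : set T) :
  exists F : {fset T}, [/\ forall x, x \in F -> A x,
    (#|` F| <= #|S|)%N & forall x, A x -> exists2 y, y \in F & f x = f y].
Proof.
have [->|/set0P[x0 Ax0]] := eqVneq A set0.
  by exists fset0; split=> //; rewrite cardfs0.
pose B s := [set x | A x /\ f x = s]%classic.
(* The default [x0] represents the values that [f] does not take on [A]. It is
   taken in [A] so that the representatives still all belong to [A]. *)
pose rep s := xget x0 (B s).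
exists [fset rep s | s in S]; split=> [x /imfsetP[s _ ->]||x Ax].
- by rewrite /rep; case: xgetP => [y _ []|].
- by apply: leq_trans (leq_imfset_card _ _ _) _; rewrite cardE.
- exists (rep (f x)); first by apply/imfsetP; exists (f x).
  by rewrite /rep; case: xgetP => [y _ []|/(_ x)[]].
Qed.

Theorem lemma2p2 (R : realType) (k r : nat) (V : vseq k r)
    (hk : (2 <= k)%N) (hV : is_flag V) :
  exists F : {fset (vseq k r)},
    [/\ forall V' : vseq k r, V' \in F -> subflag V' V,
        (#|` F| <= ((k + 1) * 2 ^ (3 ^ k)) ^ k)%N
      & forall V' : vseq k r, subflag V' V ->
          exists V'' : vseq k r,
            [/\ V'' \in F,
                forall j : 'I_r.+1,
                  \dim (V' j) = \dim (V'' j) /\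
                  (forall mu : fsprob R k, supported_on mu (@cube k) ->
                    entropy mu (V' j) = entropy mu (V'' j)),
                forall (c : 'I_r.+1 -> R) (mu : 'I_r -> fsprob R k),
                  is_threshold c ->
                  (forall j : 'I_r, supported_on (mu j) (@cube k)) ->
                  flag_e V' c mu = flag_e V'' c mu
              & proper_subflag V' V -> proper_subflag V'' V]].
Proof.
have [F [subF cardF repF]] :=
  finite_representatives (@profiles k r) [set V' | subflag V' V]%classic.
exists F; split=> // [|V' /repF[V'' FV'' /ffunP eq_prof]].
  apply: leq_trans cardF _; rewrite card_ffun card_ord card_profile_type.
  rewrite leq_pexp2l ?(flag_length _ hV) ?(ltnW hk) //.
  by rewrite muln_gt0 addn1 expn_gt0.
have {}eq_prof j : profile (V' j) = profile (V'' j).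
  by have := eq_prof j; rewrite !ffunE.
have eq_dim j : \dim (V' j) = \dim (V'' j) by apply: eq_dim_profile.
exists V''; split=> // [j|c mu _ mucube|].
- by split=> // mu; apply: eq_entropy_profile.
- by apply: eq_flag_e => // j; apply: eq_entropy_profile.
- by apply: proper_subflag_dim => //; apply: subF.
Qed.
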